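(* If $P$ is an equable polygon with vertices in $\mathbb{Z}[\omega]$, then each side length of $P$ is of the form $\sqrt3\,n$ for some positive integer $n$.
   Context: A planar polygon is equable if its perimeter equals its area. The Eisenstein lattice is $\mathbb{Z}[\omega]\subset\mathbb{C}$, where $\omega=-\frac12+i\frac{\sqrt3}{2}$. *)

(* Defs.v *)
From HB Require Import structures.
From mathcomp Require Import all_boot all_order all_algebra.
From mathcomp Require Import all_classical all_reals all_analysis.
Set Implicit Arguments.
Unset Strict Implicit.
Unset Printing Implicit Defensive.
Import Order.TTheory GRing.Theory Num.Theory.
Import numFieldNormedType.Exports.
Local Open Scope classical_set_scope.
Local Open Scope ring_scope.

(* The complex plane is R * R, the pair (x, y) standing for x + i y. The norm
   of R * R in the library is the sup norm, hence the explicit [dist]. *)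

Definition omega (R : realType) : R * R := (- (1 / 2), Num.sqrt 3 / 2).

Definition eisenstein (R : realType) : set (R * R) :=
  [set z | exists a b : int, z = ((1, 0) : R * R) *~ a + omega R *~ b].

Definition dist (R : realType) (p q : R * R) : R :=
  Num.sqrt ((p.1 - q.1) ^+ 2 + (p.2 - q.2) ^+ 2).

Definition segment (R : realType) (p q : R * R) : set (R * R) :=
  [set (1 - t) *: p + t *: q | t in `[0, 1]].

(* A polygon is given by the cyclic sequence of its vertices [v]; [ordS] is the
   cyclic successor on ['I_n], so side [i] joins [v i] to the next vertex. *)
Definition side (R : realType) (n : nat) (v : 'I_n -> R * R) (i : 'I_n) :
  set (R * R) := segment (v i) (v (ordS i)).

Definition side_length (R : realType) (n : nat) (v : 'I_n -> R * R)
  (i : 'I_n) : R := dist (v i) (v (ordS i)).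

(* Simple polygons, not necessarily convex; angles equal to pi are allowed. *)
Definition simple_polygon (R : realType) (n : nat) (v : 'I_n -> R * R) : Prop :=
  [/\ (3 <= n)%N,
      injective v,
      forall i : 'I_n, side v i `&` side v (ordS i) = [set v (ordS i)] &
      forall i j : 'I_n, j != i -> j != ordS i -> i != ordS j ->
        side v i `&` side v j = set0].

Definition boundary (R : realType) (n : nat) (v : 'I_n -> R * R) :
  set (R * R) := \bigcup_(i in [set: 'I_n]) side v i.

(* The region enclosed by the polygon: the union of the bounded connected
   components of the complement of its boundary. *)
Definition enclosed (R : realType) (n : nat) (v : 'I_n -> R * R) :
  set (R * R) :=
  [set p | (~` boundary v) p /\
           bounded_set (connected_component (~` boundary v) p)].

Definition perimeter (R : realType) (n : nat) (v : 'I_n -> R * R) : R :=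
  \sum_(i < n) side_length v i.

Definition area (R : realType) (n : nat) (v : 'I_n -> R * R) : \bar R :=
  (@lebesgue_measure R \x @lebesgue_measure R)%E (enclosed v).

Definition equable (R : realType) (n : nat) (v : 'I_n -> R * R) : Prop :=
  area v = (perimeter v)%:E.

(* Main.v *)
Require Import Defs.
From HB Require Import structures.
From mathcomp Require Import all_boot all_order all_algebra.
From mathcomp Require Import all_classical all_reals all_analysis.
From mathcomp Require Import measurable_realfun.
From mathcomp Require Import ring lra.
Import Order.TTheory GRing.Theory Num.Theory.
Import numFieldNormedType.Exports.
Local Open Scope classical_set_scope.
Local Open Scope ring_scope.
Set Implicit Arguments.
Unset Strict Implicit.
Unset Printing Implicit Defensive.

(* The area of an equable lattice polygon is a rational multiple of sqrt 3, by an
   argument that needs neither the Jordan curve theorem nor the shoelace formula.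
   The lines carrying the sides cut the plane into convex cells. Each cell avoids
   the boundary, hence lies in a single component of its complement; so the
   enclosed region is, up to the lines, a union of bounded cells. Between two
   consecutive critical abscissae (vertices and crossings of lines), the measure of
   a vertical section is therefore an affine function of the abscissa. All the data
   are rational, up to a factor sqrt 3 for ordinates, so integrating the measures of
   the sections gives a rational multiple of sqrt 3.

   The squared side lengths N_i are integers, so the sum of the sqrt (3 N_i) is
   rational. A sum of square roots of elements of a field lies in it only if each of
   them does, so 3 N_i is a square and N_i = 3 k^2. *)

(** * Sums of square roots over a field *)

Definition adjoin_sqrt (R : realType) (K : divringClosed R) (d : R) : pred R :=
  fun z => `[< exists2 x, x \in K & exists2 y, y \in K & z = x + y * Num.sqrt d >].

(** Inverses come from the conjugate: the norm x^2 - y^2 d of x + y sqrt d with y nonzero can only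
    vanish if sqrt d = x / y or sqrt d = - x / y, which would lie in [K]. *)
Lemma divring_closed_adjoin_sqrt (R : realType) (K : divringClosed R) (d : R) :
  d \in K -> 0 <= d -> Num.sqrt d \notin K -> divring_closed (adjoin_sqrt K d).
Proof.
move=> dK d0 rK; set r := Num.sqrt d; have rr : r ^+ 2 = d by rewrite sqr_sqrtr.
have inv x y : x \in K -> y \in K -> exists2 a, a \in K & exists2 b, b \in K &
    (x + y * r)^-1 = a + b * r.
  (* For y = 0 the element may be 0; the convention 0^-1 = 0 covers it. *)
  move=> xK yK; have [y0|y0] := eqVneq y 0.
    by exists x^-1; rewrite ?rpredV//; exists 0; rewrite ?rpred0// y0 !mul0r !addr0.
  have N0 : (x + y * r) * (x - y * r) != 0.
    rewrite mulf_neq0//; apply/negP => /eqP xyr; move: rK; rewrite -/r.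
      have -> : r = - x / y by apply: (mulIf y0); rewrite divfK//; lra.
      by rewrite rpred_div ?rpredN.
    have -> : r = x / y by apply: (mulIf y0); rewrite divfK//; lra.
    by rewrite rpred_div.
  have NE : (x + y * r) * (x - y * r) = x ^+ 2 - y ^+ 2 * d by rewrite -rr; ring.
  exists (x / (x ^+ 2 - y ^+ 2 * d)).
    by rewrite rpred_div ?rpredB ?rpredM ?rpredX.
  exists (- y / (x ^+ 2 - y ^+ 2 * d)).
    by rewrite rpred_div ?rpredB ?rpredM ?rpredX ?rpredN.
  move: N0; rewrite -NE mulf_eq0 => /norP[n1 n2]; field.
  by rewrite n1 n2.
split=> [|u v /asboolP[a aK [b bK ->]] /asboolP[x xK [y yK ->]]|
         u v /asboolP[a aK [b bK ->]] /asboolP[x xK [y yK ->]]]; apply/asboolP.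
- by exists 1; rewrite ?rpred1//; exists 0; rewrite ?rpred0// mul0r addr0.
- exists (a - x); first by rewrite rpredB.
  by exists (b - y); [rewrite rpredB|ring].
have [x' x'K [y' y'K E]] := inv _ _ xK yK.
exists (a * x' + b * y' * d); first by rewrite rpredD ?rpredM.
exists (a * y' + b * x'); first by rewrite rpredD ?rpredM.
by rewrite -/r E -rr; ring.
Qed.

(** Induction on the list, over all fields [K] at once. If sqrt d were not in [K], the induction
    hypothesis over K(sqrt d) would put every later root there, each one in [K] or a nonnegative
    [K]-multiple of sqrt d. The whole sum would then have a coefficient of at least 1 at sqrt d, so
    sqrt d would lie in [K] after all. *)
Lemma sum_sqrt_closed (R : realType) (K : divringClosed R) (s : seq R) :
  (forall b, b \in s -> 0 <= b /\ b \in K) ->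
  \sum_(b <- s) Num.sqrt b \in K -> forall b, b \in s -> Num.sqrt b \in K.
Proof.
elim: s K => // d s IH K sK; rewrite big_cons => sumK.
have [d0 dK] := sK d (mem_head _ _).
have sK' b : b \in s -> 0 <= b /\ b \in K.
  by move=> bs; apply: sK; rewrite inE bs orbT.
have [rK b|rK] := boolP (Num.sqrt d \in K).
  rewrite inE => /predU1P[->//|]; apply: IH => //.
  by have := rpredB sumK rK; rewrite addrC addKr.
have closL := divring_closed_adjoin_sqrt dK d0 rK.
pose L : divringClosed R :=
  HB.pack (adjoin_sqrt K d) (GRing.isDivringClosed.Build R (adjoin_sqrt K d) closL).
have KL b : b \in K -> b \in L.
  move=> bK; apply/asboolP; exists b => //; exists 0; rewrite ?rpred0//.
  by rewrite mul0r addr0.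
have rL : Num.sqrt d \in L.
  apply/asboolP; exists 0; rewrite ?rpred0//; exists 1; rewrite ?rpred1//.
  by rewrite mul1r add0r.
have rootL : forall b, b \in s -> Num.sqrt b \in L.
  apply: IH => [b /sK'[b0 bK]|]; first by split=> //; exact: KL.
  have -> : \sum_(b <- s) Num.sqrt b =
      Num.sqrt d + \sum_(b <- s) Num.sqrt b - Num.sqrt d.
    by ring.
  by apply: rpredB => //; exact: KL.
have r0 : 0 < Num.sqrt d.
  rewrite lt_neqAle sqrtr_ge0 andbT eq_sym.
  by apply: contra rK => /eqP ->; rewrite rpred0.
(* As [b \in K], one of the two coordinates of [Num.sqrt b] vanishes. *)
have coord b : b \in s -> exists2 x, x \in K & exists2 y, y \in K &
    0 <= y /\ Num.sqrt b = x + y * Num.sqrt d.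
  move=> bs; have /asboolP[x xK [y yK E]] := rootL _ bs.
  have [b0 bK] := sK' _ bs.
  have [y0|y0] := eqVneq y 0.
    by exists x => //; exists 0; rewrite ?rpred0// E y0.
  have [x0|x0] := eqVneq x 0.
    exists 0; rewrite ?rpred0//; exists y => //; split; last by rewrite E x0.
    by have := sqrtr_ge0 b; rewrite E x0 add0r pmulr_lge0.
  case/negP: rK.
  have xy0 : x * y *+ 2 != 0 by rewrite mulrn_eq0 mulf_eq0 (negPf x0) (negPf y0).
  have -> : Num.sqrt d = (b - x ^+ 2 - y ^+ 2 * d) / (x * y *+ 2).
    apply: (mulIf xy0); rewrite divfK//.
    have := sqr_sqrtr b0; rewrite E; have := sqr_sqrtr d0.
    by set r := Num.sqrt d => <- <-; ring.
  by rewrite rpred_div ?rpredB ?rpredMn ?rpredM ?rpredX.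
have [x xK [y yK [y0 E]]] : exists2 x, x \in K & exists2 y, y \in K &
    0 <= y /\ \sum_(b <- s) Num.sqrt b = x + y * Num.sqrt d.
  elim: s coord {IH sK sumK sK' rootL} => [|b s IH] coord.
    exists 0; rewrite ?rpred0//; exists 0; rewrite ?rpred0// big_nil.
    by rewrite mul0r add0r.
  have [|x xK [y yK [y0 E]]] := IH.
    by move=> b' b's; apply: coord; rewrite inE b's orbT.
  have [x' x'K [y' y'K [y'0 E']]] := coord b (mem_head _ _).
  exists (x' + x); rewrite ?rpredD//; exists (y' + y); rewrite ?rpredD//.
  by rewrite addr_ge0// big_cons E E'; split=> //; ring.
case/negP: rK.
(* This is where the signs matter: without 0 <= y the contributions of sqrt d could cancel. *)
have y1 : 1 + y != 0 by rewrite gt_eqF // ltr_wpDr.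
have -> : Num.sqrt d = (Num.sqrt d + \sum_(b <- s) Num.sqrt b - x) / (1 + y).
  by rewrite E; apply: (mulIf y1); rewrite divfK//; ring.
by rewrite rpred_div ?rpredB// rpredD ?rpred1.
Qed.

Definition ratr_pred (R : realType) : pred R :=
  fun x => `[< exists q : rat, x = ratr q >].

Lemma divring_closed_ratr (R : realType) : divring_closed (@ratr_pred R).
Proof.
split=> [|u v /asboolP[p ->] /asboolP[q ->]|u v /asboolP[p ->] /asboolP[q ->]];
  apply/asboolP.
- by exists 1; rewrite rmorph1.
- by exists (p - q); rewrite rmorphB.
- by exists (p / q); rewrite fmorph_div.
Qed.

(** The square of the denominator of q divides that of the numerator, so the denominator divides the
    numerator, and the quotient is [m]. *)
Lemma sqrt_nat_ratr (R : realType) (N : nat) (q : rat) :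
  Num.sqrt (N%:R : R) = ratr q -> exists m : nat, N = (m ^ 2)%N.
Proof.
move=> E; have : q ^+ 2 = N%:R.
  apply: (fmorph_inj (@ratr R)).
  by rewrite rmorphXn /= -E sqr_sqrtr// ratr_nat.
rewrite -[q]divq_num_den expr_div_n => qN.
have d0 : (denq q)%:~R ^+ 2 != 0 :> rat by rewrite expf_neq0// intr_eq0.
have : (`|numq q| ^ 2 = N * `|denq q| ^ 2)%N.
  have : numq q ^+ 2 = N%:Z * denq q ^+ 2.
    apply: (@intr_inj rat).
    by rewrite [RHS]rmorphM !rmorphXn /= [X in X * _](_ : _ = N%:R)// -qN divfK.
  by move=> /(congr1 absz); rewrite abszM !abszX absz_nat.
move=> E2; have : (`|denq q| ^ 2 %| `|numq q| ^ 2)%N by rewrite E2 dvdn_mull.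
rewrite dvdn_pexp2r// => /dvdnP[m E3]; exists m; move: E2; rewrite E3 expnMn.
by move=> /eqP; rewrite eqn_pmul2r ?expn_gt0 ?absz_gt0 ?denq_neq0// => /eqP.
Qed.

(** * Integrals of piecewise affine functions *)

Lemma measurable_affine (R : realType) (D : set R) (a b : R) :
  measurable_fun D (fun z : R => (a * z + b)%:E).
Proof.
apply: measurable_funTS; apply: measurableT_comp; first exact: EFin_measurable.
by apply: measurable_funD => //; apply: measurable_funM.
Qed.

Lemma integral_affine (R : realType) (a b x y : R) : x < y ->
  (\int[lebesgue_measure]_(z in `]x, y[) (a * z + b)%:E =
  (a * (y ^+ 2 - x ^+ 2) / 2 + b * (y - x))%:E)%E.
Proof.
move=> xy.
pose F (z : R) := a / 2 * z ^+ 2 + b * z.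
have cf : continuous (fun z : R => a * z + b).
  move=> z; apply: cvgD; last exact: cvg_cst.
  by apply: cvgM; [exact: cvg_cst|exact: cvg_id].
have dF (z : R^o) : is_derive z 1 (F : R^o -> R^o) (a * z + b).
  rewrite /F; apply: is_derive_eq.
  by rewrite /= /GRing.scale/= !mulr1; field.
have cF : continuous (F : R^o -> R^o).
  move=> z; apply: differentiable_continuous; apply/derivable1_diffP.
  by have [] := dF z.
(* Passing to the closed interval changes nothing and makes the fundamental theorem of calculus
   applicable. *)
rewrite -(@integral_itv_bndoo _ _ _ _ true false); last first.
  exact: measurable_affine.
rewrite (@continuous_FTC2 _ (fun z => a * z + b) F)//.
- by rewrite -EFinB /F; congr EFin; field.
- exact: continuous_subspaceT.
- split=> [z _||]; first by have [] := dF z.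
    exact: cvg_at_right_filter (cF x).
  exact: cvg_at_left_filter (cF y).
- by move=> z _; rewrite derive1E; have [_ ->] := dF z.
Qed.

(** The breakpoints are [x :: s]; the values of [g] there are arbitrary, as points have measure
    zero. Measurability is a conclusion, so nothing about the regularity of [g] has to be known
    beforehand. The induction peels off the leftmost interval. *)
Lemma integral_piecewise_affine_right (R : realType) (x : R) (s : seq R)
    (a b : nat -> R) (g : R -> \bar R) :
  path <%R x s ->
  (forall k, (k < size s)%N -> forall y, nth 0 (x :: s) k < y < nth 0 s k ->
     g y = (a k * y + b k)%:E) ->
  (forall y, last x s < y -> g y = 0%E) ->
  measurable_fun `]x, +oo[ g /\
  (\int[lebesgue_measure]_(y in `]x, +oo[) g y = (\sum_(k < size s)
    (a k * ((nth 0 s k) ^+ 2 - (nth 0 (x :: s) k) ^+ 2) / 2 +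
     b k * (nth 0 s k - nth 0 (x :: s) k)))%:E)%E.
Proof.
elim: s x a b => [|z s IH] x a b /=.
  move=> _ _ g0; rewrite big_ord0; split.
    apply: (@eq_measurable_fun _ _ _ _ _ (cst 0%E)); last exact: measurable_cst.
    by move=> y; rewrite inE/= in_itv/= andbT => /g0.
  rewrite -[RHS](integral0 lebesgue_measure `]x, +oo[).
  by apply: eq_integral => y; rewrite inE/= in_itv/= andbT => /g0.
move=> /andP[xz zs] gE g0.
have [mz iz] := IH z (a \o succn) (b \o succn) zs (fun k => gE k.+1) g0.
have gxz y : y \in `]x, z[ -> g y = (a 0%N * y + b 0%N)%:E.
  by rewrite in_itv/= => yxz; apply: (gE 0%N).
have mxz : measurable_fun `]x, z[ g.
  apply: (@eq_measurable_fun _ _ _ _ _ (fun y => (a 0%N * y + b 0%N)%:E)).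
    by move=> y; rewrite inE => /gxz ->.
  exact: measurable_affine.
have E : `]x, +oo[%classic = `]x, z[ `|` ([set z] `|` `]z, +oo[).
  rewrite setU1itv// -itv_bndbnd_setU//= bnd_simp; exact: ltW.
have mz1 : measurable_fun ([set z] `|` `]z, +oo[) g.
  by apply/measurable_funU => //; split=> //; exact: measurable_fun_set1.
have m : measurable_fun `]x, +oo[ g.
  by rewrite E; apply/measurable_funU => //; exact: measurableU.
split=> //; rewrite E integral_setU//=; last first.
- apply/disj_setPS => y []; rewrite /= !in_itv/= => /andP[_ yz] [yE|].
    by rewrite yE ltxx in yz.
  by rewrite andbT => /(lt_trans yz); rewrite ltxx.
- by rewrite -E.
- exact: measurableU.
rewrite integral_setU//=; last first.
  by apply/disj_setPS => y [/= ->]; rewrite in_itv/= ltxx.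
rewrite integral_set1 add0e iz big_ord_recl/= EFinD; congr (_ + _)%E.
rewrite -(integral_affine _ _ xz); apply: eq_integral => y.
by rewrite inE => /gxz.
Qed.

Lemma integral_piecewise_affine (R : realType) (x : R) (s : seq R)
    (a b : nat -> R) (g : R -> \bar R) :
  path <%R x s ->
  (forall k, (k < size s)%N -> forall y, nth 0 (x :: s) k < y < nth 0 s k ->
     g y = (a k * y + b k)%:E) ->
  (forall y, y < x -> g y = 0%E) ->
  (forall y, last x s < y -> g y = 0%E) ->
  measurable_fun setT g /\
  (\int[lebesgue_measure]_y g y = (\sum_(k < size s)
    (a k * ((nth 0 s k) ^+ 2 - (nth 0 (x :: s) k) ^+ 2) / 2 +
     b k * (nth 0 s k - nth 0 (x :: s) k)))%:E)%E.
Proof.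
move=> xs gE gx0 g0; have [mg ig] := integral_piecewise_affine_right xs gE g0.
have m0 : measurable_fun `]-oo, x[ g.
  apply: (@eq_measurable_fun _ _ _ _ _ (cst 0%E)); last exact: measurable_cst.
  by move=> y; rewrite inE/= in_itv/= => /gx0.
have mx : measurable_fun ([set x] `|` `]x, +oo[) g.
  by apply/measurable_funU => //; split=> //; exact: measurable_fun_set1.
have E : [set: R] = `]-oo, x[ `|` ([set x] `|` `]x, +oo[).
  by rewrite setU1itv// itv_setU_setT.
have m : measurable_fun setT g.
  by rewrite E; apply/measurable_funU => //; exact: measurableU.
split=> //; rewrite E integral_setU//=; last 3 first.
- exact: measurableU.
- by rewrite -E.
- apply/disj_setPS => y []; rewrite /= !in_itv/= => yx [yE|].
    by rewrite yE ltxx in yx.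
  by rewrite andbT => /(lt_trans yx); rewrite ltxx.
rewrite integral_setU//=; last first.
  by apply/disj_setPS => y [/= ->]; rewrite in_itv/= ltxx.
rewrite integral_set1 add0e ig -[RHS]add0e; congr (_ + _)%E.
rewrite -[RHS](integral0 lebesgue_measure `]-oo, x[).
by apply: eq_integral => y; rewrite inE/= in_itv/= => /gx0.
Qed.

(** The indicator of [A] is piecewise affine with slopes 0, which also gives the measurability of
    [A]. *)
Lemma lebesgue_measure_piecewise (R : realType) (x : R) (s : seq R)
    (b : nat -> bool) (A : set R) :
  path <%R x s ->
  (forall k, (k < size s)%N -> forall y, nth 0 (x :: s) k < y < nth 0 s k ->
     A y <-> b k) ->
  (forall y, y < x -> ~ A y) ->
  (forall y, last x s < y -> ~ A y) ->
  lebesgue_measure A = (\sum_(k < size s)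
    (b k)%:R * (nth 0 s k - nth 0 (x :: s) k))%:E.
Proof.
move=> xs AE Ax A0.
have [|||m i] := @integral_piecewise_affine R x s (fun=> 0) (fun k => (b k)%:R)
    (fun y => (\1_A y)%:E) xs.
- move=> k ks y ky; rewrite mul0r add0r indicE; congr (_%:R)%:E.
  congr nat_of_bool; apply/idP/idP => [/set_mem/(AE k ks y ky)//|bk].
  by rewrite inE; apply/(AE k ks y ky).
- by move=> y yx; rewrite indicE memNset//; exact: Ax.
- by move=> y yx; rewrite indicE memNset//; exact: A0.
have mA : measurable A by apply/(@measurable_indicP _ _ R)/measurable_EFinP.
transitivity (\int[lebesgue_measure]_y (\1_A y)%:E)%E.
  by rewrite integral_indic// setIT.
rewrite i; congr EFin.
by apply: eq_bigr => k _; rewrite !mul0r add0r.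
Qed.

(** * Convex combinations and increasing sequences *)

Lemma lerp_gt0 (R : realType) (t a b : R) :
  0 <= t <= 1 -> 0 < a -> 0 < b -> 0 < (1 - t) * a + t * b.
Proof.
move=> /andP[]; rewrite le_eqVlt => /predU1P[<- _|t0 t1] a0 b0.
  by rewrite subr0 mul1r mul0r addr0.
by rewrite ltr_wpDl ?mulr_ge0 ?mulr_gt0 ?subr_ge0 ?(ltW a0).
Qed.

Lemma lerp_lt (R : realType) (t a b x y : R) :
  0 <= t <= 1 -> a < b -> x < y -> (1 - t) * a + t * x < (1 - t) * b + t * y.
Proof.
rewrite -subr_gt0 -(subr_gt0 x) -(subr_gt0 (_ + _)) => t01 ab xy.
by have := lerp_gt0 t01 ab xy; lra.
Qed.

Lemma path_lt_bounds (R : realType) (a : R) (s : seq R) (y : R) :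
  path <%R a s -> y \in a :: s -> a <= y <= last a s.
Proof.
elim: s a y => [|b s IH] a y /=; first by rewrite inE => _ /eqP ->; rewrite lexx.
move=> /andP[ab bs]; rewrite inE => /predU1P[->|/(IH _ _ bs)/andP[by_ ->]].
  by have /andP[_ bl] := IH b b bs (mem_head _ _); rewrite lexx (le_trans (ltW ab)).
by rewrite (le_trans (ltW ab)).
Qed.

Lemma path_lt_gap (R : realType) (a : R) (s : seq R) (k : nat) (y : R) :
  path <%R a s -> (k < size s)%N -> y \in a :: s ->
  y <= nth 0 (a :: s) k \/ nth 0 s k <= y.
Proof.
elim: s a k => // b s IH a k abs; rewrite /= ltnS => ks.
have /andP[ab bs] : (a < b) && path <%R b s := abs.
rewrite inE => /predU1P[->|ybs].
  have : nth 0 (a :: b :: s) k \in a :: b :: s by rewrite mem_nth//= ltnS leqW.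
  by move=> /(path_lt_bounds abs)/andP[]; left.
case: k ks => [_|k ks]; first by right; have /andP[] := path_lt_bounds bs ybs.
exact: IH.
Qed.

(** * Segments, rays and the enclosed region *)

Lemma segment_lerp (R : realType) (p q z : R * R) : segment p q z <->
  exists2 t, 0 <= t <= 1 & z = ((1 - t) * p.1 + t * q.1, (1 - t) * p.2 + t * q.2).
Proof. by split=> [[t]|[t t01 ->]]; [rewrite /= in_itv/= => t01 <-|]; exists t. Qed.

Lemma connected_segment (R : realType) (p q : R * R) : connected (segment p q).
Proof.
apply: connected_continuous_connected; first exact: segment_connected.
apply: continuous_subspaceT => t; apply: cvgD; apply: cvgZr_tmp; last exact: cvg_id.
by apply: cvgB; [exact: cvg_cst|exact: cvg_id].
Qed.

Lemma connected_component_segment (R : realType) (A : set (R * R)) (p q : R * R) :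
  segment p q `<=` A -> connected_component A p q.
Proof.
move=> pqA.
have sp : segment p q p.
  apply/segment_lerp; exists 0; rewrite ?lexx ?ler01//.
  by rewrite subr0 !mul1r !mul0r !addr0 -surjective_pairing.
have sq : segment p q q.
  apply/segment_lerp; exists 1; rewrite ?lexx ?ler01//.
  by rewrite subrr !mul1r !mul0r !add0r -surjective_pairing.
exact: (connected_component_max sp pqA (@connected_segment R p q)).
Qed.

Lemma enclosed_segment (R : realType) (n : nat) (v : 'I_n -> R * R) (p q : R * R) :
  segment p q `<=` ~` boundary v -> enclosed v p <-> enclosed v q.
Proof.
move=> pqB; have pq := connected_component_segment pqB.
have qB := connected_component_sub pq.
have pB := connected_component_sub (connected_component_sym pq).
by rewrite /enclosed /= (same_connected_component pq); split=> -[].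
Qed.

(** The component of [p] contains the whole vertical ray, upward for [e = 1] and downward for
    [e = -1], hence is unbounded. *)
Lemma ray_not_enclosed (R : realType) (n : nat) (v : 'I_n -> R * R) (p : R * R)
    (e : R) :
  `|e| = 1 -> (forall t, 0 <= t -> ~ boundary v (p.1, p.2 + t * e)) ->
  ~ enclosed v p.
Proof.
move=> e1 ray [_ /pinfty_ex_gt0[M M0 /= bM]].
(* At parameter [T] the ordinate has absolute value at least [T] - |p.2| = M + 1, beyond the bound
   [M]. *)
pose T := M + `|p.2| + 1.
have T0 : 0 <= T by rewrite /T; have := normr_ge0 p.2; lra.
have := bM (p.1, p.2 + T * e).
rewrite prod_normE ge_max/= => /(_ _)/andP[].
  apply: connected_component_segment => z /segment_lerp[t /andP[t0 t1] ->]/=.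
  have -> : (1 - t) * p.1 + t * p.1 = p.1 by ring.
  have -> : (1 - t) * p.2 + t * (p.2 + T * e) = p.2 + (t * T) * e by ring.
  by apply: ray; rewrite mulr_ge0.
move=> _; apply/negP; rewrite -ltNge.
have : `|T * e| <= `|p.2 + T * e| + `|p.2|.
  by rewrite -(normrN p.2) (le_trans _ (ler_normD _ _))// addrC addKr.
by rewrite normrM e1 mulr1 ger0_norm// /T; lra.
Qed.

(** * Lines over vertical strips *)

Definition line_at (R : realType) (f : R * R) (x : R) : R := f.1 * x + f.2.

(** For parallel or equal lines this is 0, since [x / 0 = 0]; the only effect is to make 0 a further
    critical abscissa. *)
Definition meet_abscissa (R : realType) (f g : R * R) : R :=
  (g.2 - f.2) / (f.1 - g.1).

Lemma line_atB (R : realType) (f g : R * R) (x : R) : f.1 != g.1 ->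
  line_at g x - line_at f x = (g.1 - f.1) * (x - meet_abscissa f g).
Proof.
rewrite -subr_eq0 => fg; rewrite /line_at /meet_abscissa; field.
by [].
Qed.

(* Vertical sides get the slope 0 since [x / 0 = 0]; such extra lines are
   harmless. *)
Definition side_line (R : realType) (n : nat) (v : 'I_n -> R * R) (i : 'I_n) : R * R :=
  let p := v i in let q := v (ordS i) in
  let a := (q.2 - p.2) / (q.1 - p.1) in (a, p.2 - a * p.1).

Lemma boundary_lerp (R : realType) (n : nat) (v : 'I_n -> R * R) (x y : R) :
  boundary v (x, y) -> exists i, exists2 t, 0 <= t <= 1 &
    x = (1 - t) * (v i).1 + t * (v (ordS i)).1 /\
    y = (1 - t) * (v i).2 + t * (v (ordS i)).2.
Proof. by move=> [i _ /segment_lerp[t t01 [-> ->]]]; exists i, t. Qed.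

Lemma boundary_side_line (R : realType) (n : nat) (v : 'I_n -> R * R) (x y : R) :
  boundary v (x, y) -> (forall i, (v i).1 != x) ->
  exists i, y = line_at (side_line v i) x.
Proof.
move=> /boundary_lerp[i [t _ [xE yE]]] vx; exists i; rewrite /line_at /side_line.
set p := v i in xE yE *; set q := v (ordS i) in xE yE *.
(* On a vertical side, [x] would be the abscissa of a vertex. *)
have pq : q.1 - p.1 != 0.
  apply/eqP => pq; have /eqP[] := vx i; rewrite -/p.
  by rewrite xE (_ : q.1 = p.1); [ring|lra].
by rewrite xE yE /=; field.
Qed.

(* [L] cuts the strip [c < x < d] into cells, the bounded ones of which lie either
   inside or outside [E]; the unbounded ones lie outside. *)
Record slab (R : realType) (E : set (R * R)) (L : seq (R * R)) (c d : R) :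
    Prop := Slab {
  slab_lt : c < d;
  slab_lines : L != [::];
  slab_meet : forall f g, f \in L -> g \in L -> ~~ (c < meet_abscissa f g < d);
  slab_cell : forall p q : R * R, c < p.1 < d -> c < q.1 < d ->
    (forall t f, 0 <= t <= 1 -> f \in L ->
       (1 - t) * p.2 + t * q.2 != line_at f ((1 - t) * p.1 + t * q.1)) ->
    E p <-> E q;
  slab_above : forall x y, c < x < d -> (forall f, f \in L -> line_at f x < y) ->
    ~ E (x, y);
  slab_below : forall x y, c < x < d -> (forall f, f \in L -> y < line_at f x) ->
    ~ E (x, y) }.

(** The difference of two non-parallel lines changes sign only at their crossing, which lies outside
    the strip. So the vertical order of the lines is the same over the whole strip. *)
Lemma slab_line_at_lt (R : realType) (E : set (R * R)) (L : seq (R * R)) (c d : R)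
    (f g : R * R) (x y : R) : slab E L c d -> f \in L -> g \in L ->
  c < x < d -> c < y < d -> line_at f x < line_at g x -> line_at f y < line_at g y.
Proof.
move=> H fL gL xcd ycd; rewrite -(subr_gt0 (line_at f x)) -(subr_gt0 (line_at f y)).
have [fg|fg] := eqVneq f.1 g.1; first by rewrite /line_at fg; lra.
have := slab_meet H fL gL; rewrite !line_atB//.
case/nandP; rewrite -leNgt => z; have [fg0|fg0|/eqP] := ltgtP 0 (g.1 - f.1);
  try by [rewrite eq_sym subr_eq0 eq_sym (negPf fg)]; nra.
Qed.

Lemma slab_line_at_inj (R : realType) (E : set (R * R)) (L : seq (R * R)) (c d : R)
    (x : R) : slab E L c d -> c < x < d -> {in L &, injective (@line_at R ^~ x)}.
Proof.
move=> H xcd f g fL gL /= fgx; have [fg|fg] := eqVneq f.1 g.1.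
  move: fgx; rewrite /line_at fg => /addrI fg2.
  by rewrite (surjective_pairing f) fg fg2 -surjective_pairing.
have := slab_meet H fL gL; have /eqP := line_atB x fg.
rewrite fgx subrr eq_sym mulf_eq0.
by rewrite !subr_eq0 (eq_sym g.1) (negPf fg) => /eqP <-; rewrite xcd.
Qed.

(** A section is, up to finitely many points, a union of gaps between consecutive lines. Which gaps
    occur does not depend on the abscissa, so the measure is a fixed sum of differences of lines.
    The factor [w] is there to become sqrt 3, the common irrational factor of slopes and
    intercepts. *)
Lemma slab_section (R : realType) (E : set (R * R)) (L : seq (R * R)) (c d : R)
    (K : divringClosed R) (w : R) :
  slab E L c d ->
  (forall f, f \in L -> f.1 / w \in K /\ f.2 / w \in K) ->
  exists a b, [/\ a / w \in K, b / w \in K & forall x, c < x < d ->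
    lebesgue_measure (xsection E x) = (a * x + b)%:E].
Proof.
move=> H LK; have [cd L0 _ cell above below] := H; pose x0 := (c + d) / 2.
have x0cd : c < x0 < d by rewrite /x0; lra.
pose e (x : R) : rel (R * R) := fun f g => line_at f x < line_at g x.
(* The distinct lines, from bottom to top at the middle of the strip; the order is strict since
   distinct lines do not meet over the strip. *)
pose Ls := sort (relpre (@line_at R ^~ x0) <=%R) (undup L).
have memLs f : (f \in Ls) = (f \in L) by rewrite mem_sort mem_undup.
have Ls0 : sorted (e x0) Ls.
  rewrite /e -(sorted_map (f := @line_at R ^~ x0) (e' := <%R)) /Ls -sort_map.
  rewrite sort_lt_sorted.
  rewrite map_inj_in_uniq ?undup_uniq// => f g; rewrite !mem_undup.
  by move=> fL gL; exact: (slab_line_at_inj H x0cd fL gL).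
have Lsx x : c < x < d -> sorted (e x) Ls.
  move=> xcd; move: Ls0; apply: (@sub_in_sorted _ (mem L) (e x0) (e x) _ Ls).
    by move=> f g fL gL; exact: slab_line_at_lt H fL gL _ _.
  by apply/allP => f; rewrite memLs.
have L0Ls : head 0 L \in Ls.
  by rewrite memLs; case: (L) L0 => //= f s _; exact: mem_head.
case: Ls L0Ls memLs Ls0 Lsx => // f0 fs _ memLs _ Lsx.
pose F k := nth 0 (f0 :: fs) k; pose G k := nth 0 fs k.
have FL k : (k < size fs)%N -> F k \in L.
  by move=> kfs; rewrite -memLs mem_nth//= ltnW.
have GL k : (k < size fs)%N -> G k \in L.
  by move=> kfs; rewrite -memLs inE mem_nth ?orbT.
have nthF (x : R) k : (k < size fs)%N ->
    nth 0 (line_at f0 x :: map (@line_at R ^~ x) fs) k = line_at (F k) x.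
  by move=> kfs; rewrite -(map_cons (@line_at R ^~ x)) (nth_map 0)//= ltnW.
have nthG (x : R) k : (k < size fs)%N ->
    nth 0 (map (@line_at R ^~ x) fs) k = line_at (G k) x.
  by move=> kfs; rewrite (nth_map 0).
have pathL (x : R) : c < x < d -> path <%R (line_at f0 x) (map (@line_at R ^~ x) fs).
  by move=> /Lsx; rewrite /e -(sorted_map (f := @line_at R ^~ x) (e' := <%R)).
have lineL (x : R) f : f \in L ->
    line_at f x \in line_at f0 x :: map (@line_at R ^~ x) fs.
  by move=> fL; apply: (@map_f _ _ (@line_at R ^~ x) (f0 :: fs)); rewrite memLs.
have FGlt (x : R) k : c < x < d -> (k < size fs)%N -> line_at (F k) x < line_at (G k) x.
  move=> xcd kfs; rewrite -nthF// -nthG//.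
  by move: (pathL x xcd) => /(pathP 0); apply; rewrite size_map.
have gap (x : R) k f : c < x < d -> (k < size fs)%N -> f \in L ->
    line_at f x <= line_at (F k) x \/ line_at (G k) x <= line_at f x.
  move=> xcd kfs fL; rewrite -nthF// -nthG//; apply: path_lt_gap; first exact: pathL.
    by rewrite size_map.
  exact: lineL.
(* A sample point of the [k]-th bounded cell decides whether the cell lies in [E]. *)
pose mid k := (x0, (line_at (F k) x0 + line_at (G k) x0) / 2).
pose b k := `[< E (mid k) >].
have Eb (x : R) k : c < x < d -> (k < size fs)%N -> forall y,
    line_at (F k) x < y < line_at (G k) x -> E (x, y) <-> b k.
  move=> xcd kfs y /andP[Fy yG].
  apply: (iff_trans _ (rwP (asboolP _))).
  (* The segment from (x, y) to the sample point stays strictly between the lines [F k] and [G k],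
     and no line of [L] passes between these two. *)
  apply: cell => //= t f t01 fL.
  set z := (1 - t) * x + t * x0; set u := (1 - t) * y + t * _.
  have zcd : c < z < d.
    have zE : forall r : R, r = (1 - t) * r + t * r by move=> r; ring.
    move: x0cd xcd => /andP[? ?] /andP[? ?].
    by rewrite /z (zE c) (zE d) !lerp_lt.
  have uE : forall f', line_at f' z = (1 - t) * line_at f' x + t * line_at f' x0.
    by move=> f'; rewrite /line_at /z; ring.
  have midFG := midf_lt (FGlt x0 k x0cd kfs).
  have Fu : line_at (F k) z < u.
    by rewrite uE lerp_lt// midFG.
  have uG : u < line_at (G k) z.
    by rewrite uE lerp_lt// midFG.
  have [fF|Gf] := gap z k f zcd kfs fL.
    by rewrite gt_eqF// (le_lt_trans fF).
  by rewrite lt_eqF// (lt_le_trans _ Gf).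
exists (\sum_(k < size fs) (b k)%:R * ((G k).1 - (F k).1)).
exists (\sum_(k < size fs) (b k)%:R * ((G k).2 - (F k).2)).
split=> [||x xcd].
- rewrite mulr_suml; apply: rpred_sum => k _; rewrite -mulrA rpredM ?rpred_nat//.
  by rewrite mulrBl rpredB// ?(LK _ (GL _ _)).1 ?(LK _ (FL _ _)).1.
- rewrite mulr_suml; apply: rpred_sum => k _; rewrite -mulrA rpredM ?rpred_nat//.
  by rewrite mulrBl rpredB// ?(LK _ (GL _ _)).2 ?(LK _ (FL _ _)).2.
rewrite (lebesgue_measure_piecewise (b := b) (pathL x xcd)).
- rewrite size_map; congr EFin; rewrite mulr_suml -big_split/=; apply: eq_bigr => k _.
  by rewrite nthF// nthG// /line_at; ring.
- move=> k; rewrite size_map => kfs y; rewrite nthF// nthG// => /(Eb x k xcd kfs).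
  by rewrite /xsection/= inE.
- move=> y yf0; rewrite /xsection/= inE; apply: below => // f fL.
  by have /andP[/(lt_le_trans yf0)] := path_lt_bounds (pathL x xcd) (lineL x f fL).
- move=> y yf0; rewrite /xsection/= inE; apply: above => // f fL.
  by have /andP[_ /le_lt_trans] := path_lt_bounds (pathL x xcd) (lineL x f fL); apply.
Qed.

(** * The area of a polygon *)

Definition side_lines (R : realType) (n : nat) (v : 'I_n -> R * R) : seq (R * R) :=
  [seq side_line v i | i <- enum 'I_n].

Definition critical_abscissae (R : realType) (n : nat) (v : 'I_n -> R * R) : seq R :=
  [seq (v i).1 | i <- enum 'I_n] ++
  [seq meet_abscissa f g | f <- side_lines v, g <- side_lines v].

(** Over a strip free of vertex abscissae every boundary point lies on the line of a non-vertical
    side. A segment avoiding all lines thus avoids the boundary, and so does a ray going up from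
    above them all or down from below. *)
Lemma polygon_slab (R : realType) (n : nat) (v : 'I_n -> R * R) (c d : R) :
  (0 < n)%N -> c < d -> (forall x, x \in critical_abscissae v -> ~~ (c < x < d)) ->
  slab (enclosed v) (side_lines v) c d.
Proof.
move=> n0 cd crit.
have vx x : c < x < d -> forall i, (v i).1 != x.
  move=> xcd i; apply: contraTneq xcd => <-; apply: crit.
  by rewrite mem_cat (map_f (fun i => (v i).1)) ?mem_enum.
have on_line x y : c < x < d -> boundary v (x, y) ->
    exists2 f, f \in side_lines v & y = line_at f x.
  move=> /vx xv /boundary_side_line/(_ xv)[i ->].
  by exists (side_line v i) => //; rewrite map_f ?mem_enum.
split=> //.
- by rewrite -size_eq0 size_map size_enum_ord -lt0n.
- move=> f g fL gL; apply: crit; rewrite mem_cat.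
  by apply/orP; right; apply/allpairsP; exists (f, g).
- move=> p q /andP[cp pd] /andP[cq qd] pq; apply: enclosed_segment.
  move=> z /segment_lerp[t t01 ->].
  have idE (r : R) : r = (1 - t) * r + t * r by ring.
  move/on_line => [|f fL]; first by rewrite (idE c) (idE d) !lerp_lt.
  exact/eqP/pq.
- move=> x y xcd yL; apply: (@ray_not_enclosed _ _ _ _ 1); rewrite ?normr1//=.
  move=> t t0 /on_line[//|f fL]; have := yL f fL; rewrite mulr1; lra.
- move=> x y xcd yL; apply: (@ray_not_enclosed _ _ _ _ (-1)).
    by rewrite normrN1.
  move=> t t0 /= /on_line[//|f fL]; have := yL f fL; rewrite mulrN1; lra.
Qed.

Lemma not_enclosed_left (R : realType) (n : nat) (v : 'I_n -> R * R) (x y : R) :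
  (forall i, x < (v i).1) -> ~ enclosed v (x, y).
Proof.
move=> xv; apply: (@ray_not_enclosed _ _ _ _ 1); rewrite ?normr1//=.
move=> t t0 /boundary_lerp[i [s s01 [xE _]]].
by have := lerp_lt s01 (xv i) (xv (ordS i)); rewrite -xE; lra.
Qed.

Lemma not_enclosed_right (R : realType) (n : nat) (v : 'I_n -> R * R) (x y : R) :
  (forall i, (v i).1 < x) -> ~ enclosed v (x, y).
Proof.
move=> xv; apply: (@ray_not_enclosed _ _ _ _ 1); rewrite ?normr1//=.
move=> t t0 /boundary_lerp[i [s s01 [xE _]]].
by have := lerp_lt s01 (xv i) (xv (ordS i)); rewrite -xE; lra.
Qed.

(** Abscissae lie in [K] and ordinates in [w] K, hence slopes and intercepts lie in [w] K.
    Integrating over intervals with ends in [K] stays in [w] K. *)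
Lemma area_closed (R : realType) (n : nat) (v : 'I_n -> R * R)
    (K : divringClosed R) (w : R) : (0 < n)%N -> w != 0 ->
  (forall i, (v i).1 \in K /\ (v i).2 / w \in K) ->
  exists2 r, r / w \in K & area v = r%:E.
Proof.
move=> n0 w0 vK.
have LK f : f \in side_lines v -> f.1 / w \in K /\ f.2 / w \in K.
  move=> /mapP[i _ ->]; rewrite /side_line /=.
  have [p1 p2] := vK i; have [q1 q2] := vK (ordS i).
  set a := _ / (_ - _); have aK : a / w \in K.
    by rewrite /a mulrAC mulrBl rpred_div ?rpredB.
  by split=> //; rewrite mulrBl mulrAC rpredB// rpredM.
have critK x : x \in critical_abscissae v -> x \in K.
  rewrite mem_cat => /orP[/mapP[i _ ->]|/allpairsP[[f g] [fL gL ->]]].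
    by have [] := vK i.
  have [f1 f2] := LK f fL; have [g1 g2] := LK g gL; rewrite /meet_abscissa /=.
  (* The factor [w] cancels, so crossings have their abscissae in [K]. *)
  have -> : (g.2 - f.2) / (f.1 - g.1) = ((g.2 - f.2) / w) / ((f.1 - g.1) / w).
    by rewrite invf_div mulrA divfK.
  by rewrite [(g.2 - f.2) / w]mulrBl [(f.1 - g.1) / w]mulrBl rpred_div// rpredB.
pose i0 := Ordinal n0.
pose xs := sort <=%R (undup (critical_abscissae v)).
have mem_xs x : (x \in xs) = (x \in critical_abscissae v).
  by rewrite mem_sort mem_undup.
have : sorted <%R xs by rewrite sort_lt_sorted undup_uniq.
have v_xs i : (v i).1 \in xs.
  by rewrite mem_xs mem_cat (map_f (fun i => (v i).1)) ?mem_enum.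
case: xs mem_xs v_xs => [_ /(_ i0)//|x s] mem_xs v_xs xs_lt.
have /choice[ab abP] k : exists ab : R * R, (k < size s)%N ->
    [/\ ab.1 / w \in K, ab.2 / w \in K & forall y, nth 0 (x :: s) k < y < nth 0 s k ->
      lebesgue_measure (xsection (enclosed v) y) = (ab.1 * y + ab.2)%:E].
  have [ks|ks] := ltnP k (size s); last by exists (0, 0).
  have [|y yX|a [b abP]] := @slab_section _ _ _ _ _ K w
    (@polygon_slab _ _ v (nth 0 (x :: s) k) (nth 0 s k) n0 _ _) LK.
  - by move/(pathP 0) : xs_lt; apply.
  - rewrite -mem_xs in yX; have [yk|ky] := path_lt_gap xs_lt ks yX.
      by rewrite ltNge yk.
    by rewrite andbC ltNge ky.
  by exists (a, b).
pose r := \sum_(k < size s)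
    ((ab k).1 * ((nth 0 s k) ^+ 2 - (nth 0 (x :: s) k) ^+ 2) / 2 +
     (ab k).2 * (nth 0 s k - nth 0 (x :: s) k)).
exists r.
  rewrite mulr_suml; apply: rpred_sum => k _.
  have [aK bK _] := abP k (ltn_ord k).
  have sK : nth 0 s k \in K by rewrite critK// -mem_xs inE mem_nth ?orbT.
  have xsK : nth 0 (x :: s) k \in K by rewrite critK// -mem_xs mem_nth//= ltnS ltnW.
  rewrite (_ : _ / w = (ab k).1 / w * (nth 0 s k ^+ 2 - nth 0 (x :: s) k ^+ 2) / 2 +
    (ab k).2 / w * (nth 0 s k - nth 0 (x :: s) k)); last by field.
  apply: rpredD; last by apply: rpredM => //; exact: rpredB.
  apply: rpred_div; rewrite ?rpred_nat//.
  by apply: rpredM => //; rewrite rpredB ?rpredX.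
(* By definition the product measure integrates the measures of the vertical sections. *)
rewrite /area /product_measure1.
have [|||_ ->//] := @integral_piecewise_affine R x s (fst \o ab) (snd \o ab)
    (lebesgue_measure \o xsection (enclosed v)) xs_lt.
- by move=> k ks y yk; have [_ _ ab_k] := abP k ks; exact: ab_k.
- move=> y yx; rewrite /= (_ : xsection _ _ = set0) ?measure0//.
  rewrite -subset0 => z; rewrite /xsection/= inE; apply: not_enclosed_left => i.
  by have /andP[/(lt_le_trans yx)] := path_lt_bounds xs_lt (v_xs i).
- move=> y yx; rewrite /= (_ : xsection _ _ = set0) ?measure0//.
  rewrite -subset0 => z; rewrite /xsection/= inE; apply: not_enclosed_right => i.
  by have /andP[_ /le_lt_trans] := path_lt_bounds xs_lt (v_xs i); apply.
Qed.

(** * Eisenstein vertices and side lengths *)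

Lemma eisenstein_coordE (R : realType) (z : R * R) : eisenstein z ->
  exists a b : int, z.1 = a%:~R - b%:~R / 2 /\ z.2 = Num.sqrt 3 * (b%:~R / 2).
Proof.
move=> [a [b ->]]; exists a, b; rewrite /omega.
have fstE (p : R * R) c : (p *~ c).1 = p.1 *~ c by rewrite (raddfMz fst).
have sndE (p : R * R) c : (p *~ c).2 = p.2 *~ c by rewrite (raddfMz snd).
rewrite /= fstE sndE fstE sndE /=.
rewrite -(mulrzl (- (1 / 2))) -(mulrzl (Num.sqrt 3 / 2)) mul0rz add0r.
by split; ring.
Qed.

Lemma eisenstein_distE (R : realType) (p q : R * R) : eisenstein p -> eisenstein q ->
  exists N : nat, dist p q = Num.sqrt (N%:R).
Proof.
move=> /eisenstein_coordE[a [b [p1 p2]]] /eisenstein_coordE[c [d [q1 q2]]].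
(* [M] is the norm of p - q = A + B omega in the Eisenstein integers. *)
pose A := a - c; pose B := b - d; pose M := A ^+ 2 - A * B + B ^+ 2.
have M0 : 0 <= M by rewrite /M; nra.
exists `|M|%N; rewrite /dist; congr Num.sqrt.
have -> : (`|M|%N)%:R = M%:~R :> R by rewrite pmulrn gez0_abs.
rewrite p1 p2 q1 q2 -mulrBr exprMn sqr_sqrtr// /M /A /B.
by rewrite !(rmorphD, rmorphB, rmorphM, rmorphXn)/=; field.
Qed.

Theorem lemma1 (R : realType) (n : nat) (v : 'I_n -> R * R)
  (hpoly : simple_polygon v)
  (hvert : forall i : 'I_n, eisenstein (v i))
  (hequable : equable v) :
  forall i : 'I_n,
    exists k : nat, (0 < k)%N /\ side_length v i = Num.sqrt (3%:R : R) * k%:R.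
Proof.
move=> i; have [n3 v_inj _ _] := hpoly.
have s3 : Num.sqrt (3%:R : R) != 0 by rewrite sqrtr_eq0 -ltNge.
pose Q : divringClosed R := HB.pack (@ratr_pred R)
  (GRing.isDivringClosed.Build R (@ratr_pred R) (@divring_closed_ratr R)).
have [|j|r rQ areaE] := @area_closed R n v Q (Num.sqrt 3) _ s3.
- exact: ltn_trans n3.
- have [a [b [-> ->]]] := eisenstein_coordE (hvert j).
  split; first by rewrite rpredB ?rpred_div ?rpred_int ?rpred_nat.
  by rewrite mulrC mulKf// rpred_div ?rpred_int ?rpred_nat.
have /choice[N NE] j : exists N : nat, side_length v j = Num.sqrt N%:R.
  exact: eisenstein_distE.
have sqrt3N j : Num.sqrt 3 * Num.sqrt (N j)%:R = Num.sqrt (3 * N j)%:R :> R.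
  by rewrite natrM sqrtrM.
have /sum_sqrt_closed sqrtQ : \sum_(b <- [seq (3 * N j)%:R : R | j <- enum 'I_n])
    Num.sqrt b \in Q.
  rewrite big_map big_enum/=.
  have rE : r = \sum_j side_length v j by apply/EFin_inj; rewrite -areaE.
  (* By equability the perimeter is [r], a rational multiple of sqrt 3; multiplying it by sqrt 3
     gives a rational number. *)
  have -> : \sum_j Num.sqrt (3 * N j)%:R = 3 * (r / Num.sqrt 3) :> R.
    rewrite -{1}(@sqr_sqrtr R 3)// [r / _]mulrC expr2 mulrA mulfK// rE mulr_sumr.
    by apply: eq_bigr => j _; rewrite NE sqrt3N.
  exact: (rpredM (rpred_nat Q 3) rQ).
have : Num.sqrt (3 * N i)%:R \in Q.
  apply: sqrtQ; last by rewrite (map_f (fun j => (3 * N j)%:R)) ?mem_enum.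
  by move=> _ /mapP[j _ ->]; rewrite ler0n rpred_nat.
move=> /asboolP[q /sqrt_nat_ratr[m mE]].
have /dvdnP[k mk] : (3 %| m)%N.
  have : (3 %| m ^ 2)%N by rewrite -mE dvdn_mulr.
  by rewrite Euclid_dvdX// andbT.
have {mE mk}NE3 : N i = (3 * k ^ 2)%N.
  by apply/eqP; rewrite -(eqn_pmul2l (_ : 0 < 3)%N)// mE mk; apply/eqP; ring.
have sideE : side_length v i = Num.sqrt 3 * k%:R.
  by rewrite NE NE3 natrM natrX sqrtrM// sqrtr_sqr ger0_norm.
(* For k = 0 two consecutive vertices would coincide. By injectivity [i] would be its own cyclic
   successor, which forces n = 1. *)
exists k; split=> //; rewrite lt0n; apply/eqP => k0.
have : side_length v i == 0 by rewrite sideE k0 mulr0.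
rewrite sqrtr_eq0 le_eqVlt ltNge addr_ge0 ?sqr_ge0// orbF paddr_eq0 ?sqr_ge0//.
rewrite !sqrf_eq0 !subr_eq0 => /andP[/eqP v1 /eqP v2].
have : v i = v (ordS i) by rewrite (surjective_pairing (v i)) v1 v2 -surjective_pairing.
move=> /v_inj /(congr1 val) /=.
have [iN|iN] := ltnP i.+1 n; first by rewrite modn_small// => /n_Sn.
have -> : i.+1 = n by apply/eqP; rewrite eqn_leq iN ltn_ord.
by rewrite modnn => i0; move: iN; rewrite i0 leqNgt (ltn_trans _ n3).
Qed.
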